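(* In the finite one-way scheme with two objects (see context), with morphisms $p,i_1,i_2,\sigma,c_1,c_2$ and identities, consider the subcategories (all containing both objects) $$\mathsf\Omega_{\mathrm{red}}=\langle i_1\rangle\subsetneq\mathsf\Omega_{\mathrm{sel}}=\langle i_1,i_2\rangle\subsetneq\mathsf\Omega_{\mathrm{inj}}=\langle i_1,i_2,\sigma\rangle\subsetneq\mathsf\Omega_{\mathrm{full}}$$ of $\mathsf\Omega_{\mathrm{full}}$. For each $\mathsf Q$ among these four classes, the set of the $\mathsf Q$-coherent priors $(\pi_{\omega_1},\pi_{\omega_2})$ is a polytope, of affine dimension: - for $\mathsf\Omega_{\mathrm{red}}$: $|M|^2|S|-1$ (no constraint on $\pi_{\omega_2}$); - for $\mathsf\Omega_{\mathrm{sel}}$: $|M|^2|S|-1-|S|(|M|-1)$ (the two coordinate marginals of $\pi_{\omega_2}$, on $M\times S$, agree); - for $\mathsf\Omega_{\mathrm{inj}}$: $\tfrac12|M|(|M|+1)|S|-1$ ($\pi_{\omega_2}$ is symmetric under the swap); - for $\mathsf\Omega_{\mathrm{full}}$: $|M||S|-1$ ($\pi_{\omega_2}$ is supported on the diagonal). The second and the third dimensions coincide if and only if $|M|\le2$, and their difference is $|S|\binom{|M|-1}{2}$. Thus for $|M|=2$ the equality of the two marginals implies the symmetry, and for $|M|\ge3$ it does not.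
   Context: $\mathsf\Omega_{\mathrm{full}}$ is the full subcategory of finite sets on $\omega_1=\{*\}$ and $\omega_2=\{1,2\}$; its non-identity morphisms are the merge $p:\omega_2\to\omega_1$, the selections $i_1,i_2:\omega_1\to\omega_2$ ($i_k( * )=k$), the swap $\sigma$ of $\omega_2$, and the constants $c_k=i_kp$. $\langle\cdots\rangle$ denotes the subcategory containing both objects generated by the listed morphisms. $M$ and $S$ are finite non-empty sets (of means and dispersions), $\Theta(\omega_1)=M\times S$, $\Theta(\omega_2)=M^2\times S$, with $\Theta$ contravariant: $\Theta(p)(\mu,s)=((\mu,\mu),s)$, $\Theta(i_k)((\mu_1,\mu_2),s)=(\mu_k,s)$, $\Theta(\sigma)((\mu_1,\mu_2),s)=((\mu_2,\mu_1),s)$. A prior is a pair of probability vectors $\pi_{\omega_1}$ on $\Theta(\omega_1)$ and $\pi_{\omega_2}$ on $\Theta(\omega_2)$. It is $\mathsf Q$-coherent if $\pi_\omega=\Theta(\psi)_*\pi_{\omega'}$ (pushforward) for every $\psi:\omega\to\omega'$ in $\mathsf Q$. The two coordinate marginals of $\pi_{\omega_2}$ are $\Theta(i_1)_*\pi_{\omega_2}$ and $\Theta(i_2)_*\pi_{\omega_2}$; the diagonal is $\{((\mu,\mu),s)\}$. *)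

(* Defs.v *)
From HB Require Import structures.
From Stdlib Require List.
From mathcomp Require Import all_boot all_order all_algebra.

Set Implicit Arguments.
Unset Strict Implicit.
Unset Printing Implicit Defensive.

Import Order.TTheory GRing.Theory Num.Theory.
Local Open Scope ring_scope.

(* The elements 1, 2 of omega_2 are the ordinals 0, 1 of 'I_2, and * is the
   element of 'I_1. *)
Inductive obj : Type := omega1 | omega2.

Definition size_obj (w : obj) : nat :=
  match w with omega1 => 1 | omega2 => 2 end.

Notation carrier w := 'I_(size_obj w).

Definition hom (a b : obj) := {ffun carrier a -> carrier b}.

Definition hom_id (a : obj) : hom a a := [ffun x => x].

Definition hom_comp (a b c : obj) (g : hom b c) (f : hom a b) : hom a c :=
  [ffun x => g (f x)].

Definition merge : hom omega2 omega1 := [ffun=> ord0].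
Definition select (k : 'I_2) : hom omega1 omega2 := [ffun=> k].
Definition sel1 : hom omega1 omega2 := select ord0.
Definition sel2 : hom omega1 omega2 := select ord_max.
Definition swap : hom omega2 omega2 := [ffun k => rev_ord k].
Definition const1 : hom omega2 omega2 := hom_comp sel1 merge.
Definition const2 : hom omega2 omega2 := hom_comp sel2 merge.

(* A class of morphisms; all subcategories below contain both objects. *)
Definition morphisms := forall a b : obj, hom a b -> Prop.

Inductive arrow : Type := Arrow (a b : obj) of hom a b.

Inductive generated (gens : seq arrow) : morphisms :=
| gen_base a b (f : hom a b) : List.In (Arrow f) gens -> generated gens f
| gen_id a : generated gens (hom_id a)
| gen_comp a b c (g : hom b c) (f : hom a b) :
    generated gens g -> generated gens f -> generated gens (hom_comp g f).

Definition Omega_red : morphisms := generated [:: Arrow sel1].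
Definition Omega_sel : morphisms := generated [:: Arrow sel1; Arrow sel2].
Definition Omega_inj : morphisms :=
  generated [:: Arrow sel1; Arrow sel2; Arrow swap].
Definition Omega_full : morphisms := fun a b f => True.

Definition proper_subcat (Q Q' : morphisms) : Prop :=
  (forall a b (f : hom a b), Q a b f -> Q' a b f) /\
  (exists a b (f : hom a b), Q' a b f /\ ~ Q a b f).

Section ThetaFunctor.

Variables M S : finType.

Definition Theta (w : obj) : finType :=
  match w with
  | omega1 => (M * S)%type
  | omega2 => (M * M * S)%type
  end.

Definition mean (w : obj) : Theta w -> carrier w -> M :=
  match w return Theta w -> carrier w -> M with
  | omega1 => fun t _ => t.1
  | omega2 => fun t k => if k == ord0 then t.1.1 else t.1.2
  end.

Definition disp (w : obj) : Theta w -> S :=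
  match w return Theta w -> S with
  | omega1 => fun t => t.2
  | omega2 => fun t => t.2
  end.

Definition param (w : obj) : (carrier w -> M) -> S -> Theta w :=
  match w return (carrier w -> M) -> S -> Theta w with
  | omega1 => fun mu s => (mu ord0, s)
  | omega2 => fun mu s => (mu ord0, mu ord_max, s)
  end.

(* Reindexing of the means along psi; the lemmas below give its values on the
   generating morphisms. *)
Definition Theta_map (a b : obj) (psi : hom a b) (t : Theta b) : Theta a :=
  param (fun j => mean t (psi j)) (disp t).

Lemma Theta_merge mu s : Theta_map merge (mu, s) = (mu, mu, s).
Proof. by []. Qed.

Lemma Theta_sel1 mu1 mu2 s : Theta_map sel1 (mu1, mu2, s) = (mu1, s).
Proof. by rewrite /Theta_map /= ffunE. Qed.

Lemma Theta_sel2 mu1 mu2 s : Theta_map sel2 (mu1, mu2, s) = (mu2, s).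
Proof. by rewrite /Theta_map /= ffunE. Qed.

Lemma Theta_swap mu1 mu2 s : Theta_map swap (mu1, mu2, s) = (mu2, mu1, s).
Proof. by rewrite /Theta_map /= !ffunE. Qed.

Lemma mean_param w (mu : carrier w -> M) s : mean (param mu s) =1 mu.
Proof.
case: w mu => mu k /=; first by rewrite (ord1 k).
have [-> //|] := eqVneq k ord0.
by case: k => [[|[|//]] hk] // _; congr mu; apply: val_inj.
Qed.

Lemma disp_param w (mu : carrier w -> M) s : disp (param mu s) = s.
Proof. by case: w mu. Qed.

Lemma eq_param w (mu nu : carrier w -> M) s :
  mu =1 nu -> param mu s = param nu s.
Proof. by case: w mu nu => mu nu eq_mu /=; rewrite !eq_mu. Qed.

Lemma Theta_map_id a (t : Theta a) : Theta_map (hom_id a) t = t.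
Proof. by case: a t => [[mu s]|[[mu1 mu2] s]]; rewrite /Theta_map /= ?ffunE. Qed.

Lemma Theta_map_comp a b c (g : hom b c) (f : hom a b) (t : Theta c) :
  Theta_map (hom_comp g f) t = Theta_map f (Theta_map g t).
Proof.
rewrite /Theta_map disp_param; apply: eq_param => j.
by rewrite mean_param ffunE.
Qed.

End ThetaFunctor.

Lemma hom12E (f : hom omega1 omega2) : f = sel1 \/ f = sel2.
Proof.
case E: (f ord0) => [[|[|//]] h]; [left|right]; apply/ffunP => j;
  by rewrite (ord1 j) E ffunE; apply: val_inj.
Qed.

Lemma hom_to1E a (f g : hom a omega1) : f = g.
Proof. by apply/ffunP => j; rewrite (ord1 (f j)) (ord1 (g j)). Qed.

Lemma ord2E (k : 'I_2) : k = ord0 \/ k = ord_max.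
Proof. by case: k => [[|[|//]] h]; [left|right]; apply: val_inj. Qed.

Lemma hom22E (f : hom omega2 omega2) :
  [\/ f = hom_id omega2, f = swap, f = const1 | f = const2].
Proof.
have ext (g : hom omega2 omega2) :
    f ord0 = g ord0 -> f ord_max = g ord_max -> f = g.
  by move=> e0 e1; apply/ffunP => k; case: (ord2E k) => ->.
case: (ord2E (f ord0)) (ord2E (f ord_max)) => [E0|E0] [E1|E1];
  [apply: Or43|apply: Or41|apply: Or42|apply: Or44];
  by apply: ext; rewrite ?E0 ?E1 !ffunE //; apply: val_inj.
Qed.

Section Polytopes.

Variables (R : realFieldType) (V : vectType R).

Definition affine_hull (A : V -> Prop) (z : V) : Prop :=
  exists (n : nat) (x : 'I_n -> V) (c : 'I_n -> R),
    [/\ forall i, A (x i), \sum_i c i = 1 & z = \sum_i c i *: x i].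

(* The affine hull of A is a translate of a linear subspace of dimension d; in
   particular A is non-empty. *)
Definition has_affine_dim (A : V -> Prop) (d : nat) : Prop :=
  exists (x0 : V) (U : {vspace V}),
    (\dim U = d) /\ (forall z, affine_hull A z <-> z - x0 \in U).

Definition is_polytope (A : V -> Prop) : Prop :=
  exists (n : nat) (v : 'I_n -> V), forall x,
    A x <-> exists c : 'I_n -> R,
      [/\ forall i, 0 <= c i, \sum_i c i = 1 & x = \sum_i c i *: v i].

End Polytopes.

Section Priors.

Variables (R : realFieldType) (M S : finType).

(* R^o is R regarded as a vector space over itself. *)
Definition vec (T : finType) := {ffun T -> R^o}.

Definition is_prob (T : finType) (q : vec T) : Prop :=
  (forall t, (0 : R) <= q t) /\ \sum_t q t = 1.

Definition push (T U : finType) (h : T -> U) (q : vec T) : vec U :=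
  [ffun u => \sum_(t | h t == u) q t].

Definition prior_space : vectType R :=
  ({ffun Theta M S omega1 -> R^o} * {ffun Theta M S omega2 -> R^o})%type.

Definition component (pi : prior_space) (w : obj) : vec (Theta M S w) :=
  match w return vec (Theta M S w) with
  | omega1 => pi.1
  | omega2 => pi.2
  end.

Definition is_prior (pi : prior_space) : Prop :=
  is_prob (component pi omega1) /\ is_prob (component pi omega2).

Definition coherent (Q : morphisms) (pi : prior_space) : Prop :=
  is_prior pi /\
  forall a b (psi : hom a b), Q a b psi ->
    component pi a = push (Theta_map (M := M) (S := S) psi) (component pi b).

Definition marginals_agree (q : vec (Theta M S omega2)) : Prop :=
  push (Theta_map (M := M) (S := S) sel1) q =
  push (Theta_map (M := M) (S := S) sel2) q.

Definition swap_symmetric (q : vec (Theta M S omega2)) : Prop :=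
  push (Theta_map (M := M) (S := S) swap) q = q.

Definition diagonal_supported (q : vec (Theta M S omega2)) : Prop :=
  forall mu1 mu2 s, mu1 != mu2 -> q (mu1, mu2, s) = 0.

(* The probability vectors on Theta omega2 extending to a Q-coherent prior. *)
Definition coherent_second (Q : morphisms) (q : vec (Theta M S omega2)) : Prop :=
  exists q1 : vec (Theta M S omega1), coherent Q ((q1, q) : prior_space).

End Priors.

(* Main.v *)
From HB Require Import structures.
Require Import Defs.
From mathcomp Require Import all_boot all_order all_algebra.
From mathcomp Require Import ring zify.
From Stdlib Require Import Classical.
Set Implicit Arguments.
Unset Strict Implicit.
Unset Printing Implicit Defensive.
Import Order.TTheory GRing.Theory Num.Theory.
Local Open Scope ring_scope.

(** Each of the four classes contains [sel1], so the first component of a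
coherent prior is the first marginal of the second one, and coherence becomes a
system of homogeneous linear equations on [q = pi_omega2]: none, equality of
the marginals, invariance under the swap, or vanishing off the diagonal
([coherent_red], [coherent_sel], [coherent_inj], [coherent_full]).  Hence the
coherent priors are the image, under the injective linear map
[q |-> (push sel1 q, q)], of the intersection of the probability simplex with a
linear subspace [U] ([coherent_polytope_dim]).

Such an intersection is a polytope ([simplex_slice_polytope]): pick one point
[v A] for each set [A] that supports some point; a point [x] supported in [A]
then lies between [v A] and the point where the ray from [v A] through [x]
leaves the simplex, and the latter is supported in a smaller set.  Its affine
dimension is [\dim U - 1] as soon as it contains a point [q0] which is positive
wherever some vector of [U] is nonzero ([simplex_slice_dim]): a small step from [q0]
along any vector of [U] of total mass 0 stays in the simplex, so the affine hull
is all of the hyperplane of mass 1 in [U].  The uniform distribution (on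
everything, or on the diagonal) is such a point.

It remains to compute [\dim U], that is, to find independent equations
([solution_space]).  The marginals agree when they agree at all means but one,
because they have the same total mass at each dispersion: [|S|(|M| - 1)]
equations.  Symmetry is one equation for each unordered pair of distinct means
and each dispersion: [|S| 'C(|M|, 2)].  Diagonal support is one equation for
each off-diagonal point.  The second and third dimensions therefore differ by
[|S| ('C(|M|, 2) - (|M| - 1)) = |S| 'C(|M| - 1, 2)].  Symmetry fails under
equal marginals on a 3-cycle of means at a fixed dispersion: the uniform
distribution on [(a, b), (b, c), (c, a)] has uniform marginals on [{a, b, c}].

The inclusions of the classes are strict because membership in a generated
class propagates any property shared by identities and generators and stable
under composition: fixing the first element excludes [sel2] from the first
class, monotonicity excludes [swap] from the second one and injectivity excludes
[merge] from the third one. *)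

(** * The chain of subcategories *)

Lemma generated_invariant (gens : seq arrow)
    (K : forall a b : obj, Defs.hom a b -> Prop) :
  (forall a, K a a (hom_id a)) ->
  (forall a b c (g : Defs.hom b c) (f : Defs.hom a b),
     K b c g -> K a b f -> K a c (hom_comp g f)) ->
  (forall x, List.In x gens -> let: Arrow a b f := x in K a b f) ->
  forall a b (f : Defs.hom a b), generated gens f -> K a b f.
Proof.
move=> K1 KM Kg a b f; elim=> {a b f} [a b f /Kg //|//|a b c g f _ Kgg _ Kf].
exact: KM.
Qed.

Lemma generated_mono (gens gens' : seq arrow) :
  (forall x, List.In x gens -> List.In x gens') ->
  forall a b (f : Defs.hom a b), generated gens f -> generated gens' f.
Proof.
move=> sub; apply: generated_invariant => [a|a b c g f|[a b f] /sub].
- exact: gen_id.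
- exact: gen_comp.
- exact: gen_base.
Qed.

Lemma red_proper_sel : proper_subcat Omega_red Omega_sel.
Proof.
split=> [a b f|]; first by apply: generated_mono => x /=; tauto.
exists omega1, omega2, sel2; split; first by apply: gen_base => /=; tauto.
(* [sel1] preserves the first element, and [sel2] does not. *)
pose K a b (f : Defs.hom a b) :=
  forall i : carrier a, i = 0%N :> nat -> f i = 0%N :> nat.
suff /[apply] /(_ ord0 erefl) :
  forall a b (f : Defs.hom a b), Omega_red f -> K a b f by rewrite ffunE.
apply: generated_invariant => [a i|a b c g f Kg Kf i i0|x [<-|//] i _].
- by rewrite ffunE.
- by rewrite ffunE; apply/Kg/Kf.
- by rewrite ffunE.
Qed.

Lemma sel_proper_inj : proper_subcat Omega_sel Omega_inj.
Proof.
split=> [a b f|]; first by apply: generated_mono => x /=; tauto.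
exists omega2, omega2, swap; split; first by apply: gen_base => /=; tauto.
(* The selections are monotone because their source is a point; the swap is
   not. *)
pose K a b (f : Defs.hom a b) :=
  forall i j : carrier a, (i <= j)%N -> (f i <= f j)%N.
suff /[apply] /(_ ord0 ord_max isT) :
  forall a b (f : Defs.hom a b), Omega_sel f -> K a b f by rewrite !ffunE.
apply: generated_invariant => [a i j|a b c g f Kg Kf i j ij|x].
- by rewrite !ffunE.
- by rewrite !ffunE; apply/Kg/Kf.
- by case=> [<-|[<-|//]] i j; rewrite !ffunE.
Qed.

Lemma inj_proper_full : proper_subcat Omega_inj Omega_full.
Proof.
split=> //; exists omega2, omega1, Defs.merge; split=> //.
suff /[apply] inj_merge :
  forall a b (f : Defs.hom a b), Omega_inj f -> injective f.
  have : ord0 = ord_max :> 'I_2 by apply: inj_merge; rewrite !ffunE.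
  by [].
apply: generated_invariant => [a i j|a b c g f Kg Kf i j|x].
- by rewrite !ffunE.
- by rewrite !ffunE => /Kg/Kf.
- case=> [<-|[<-|[<-|//]]] i j; rewrite ?(ord1 i) ?(ord1 j) //.
  by rewrite !ffunE => /rev_ord_inj.
Qed.

(** * Pushforward of vectors *)

Section Push.
Variables (R : realFieldType) (T U W : finType).

Lemma push_id (q : vec R T) : push id q = q.
Proof. by apply/ffunP => t; rewrite ffunE big_pred1_eq. Qed.

Lemma push_comp (g : U -> W) (h : T -> U) (q : vec R T) :
  push (g \o h) q = push g (push h q).
Proof.
apply/ffunP => w; rewrite !ffunE (partition_big h (fun u => g u == w)) //=.
apply: eq_bigr => u /eqP gu; rewrite ffunE; apply: eq_bigl => t.
by rewrite /= andb_idl // => /eqP->; apply/eqP.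
Qed.

Lemma eq_push (h1 h2 : T -> U) (q : vec R T) :
  (forall t, q t != 0 -> h1 t = h2 t) -> push h1 q = push h2 q.
Proof.
move=> eqh; apply/ffunP => u; rewrite !ffunE big_mkcond [RHS]big_mkcond /=.
apply: eq_bigr => t _; have [->|/eqh-> //] := eqVneq (q t) 0.
by rewrite !if_same.
Qed.

Lemma sum_push (h : T -> U) (q : vec R T) : \sum_u push h q u = \sum_t q t.
Proof.
rewrite [RHS](partition_big h predT) //=.
by apply: eq_bigr => u _; rewrite ffunE.
Qed.

Lemma is_prob_push (h : T -> U) (q : vec R T) :
  is_prob q -> is_prob (push h q).
Proof.
case=> q0 q1; split=> [u|]; last by rewrite sum_push.
by rewrite ffunE; apply: sumr_ge0.
Qed.

Lemma push_linear (h : T -> U) : linear (push (R := R) h).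
Proof.
move=> a x y; apply/ffunP => u; rewrite !ffunE scaler_sumr -big_split /=.
by apply: eq_bigr => t _; rewrite !ffunE.
Qed.

End Push.

HB.instance Definition _ (R : realFieldType) (T U : finType) (h : T -> U) :=
  GRing.isLinear.Build R (vec R T) (vec R U) *:%R (push h) (push_linear h).

(** * Coherence as linear equations on the second component *)

Section Coherence.
Variables (R : realFieldType) (M S : finType).
Local Notation Th f := (Theta_map (M := M) (S := S) f).
Local Notation T1 := (Theta M S omega1).
Local Notation T2 := (Theta M S omega2).
Implicit Types (r : vec R T1) (q : vec R T2).

(** Compatibility with a morphism is stable under composition, by functoriality
of [Theta_map] and [push]; hence it is enough to require it for generators. *)
Lemma coherent_generated gens (pi : prior_space R M S) :
  coherent (generated gens) pi <->
  is_prior pi /\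
  forall x, List.In x gens -> let: Arrow a b f := x in
    component pi a = push (Th f) (component pi b).
Proof.
split=> -[prior_pi coh]; split=> //.
  by case=> a b f Hf; apply: coh; apply: gen_base.
apply: generated_invariant => [a|a b c g f eqg eqf|//].
  rewrite -[LHS]push_id; apply: eq_push => t _; exact/esym/Theta_map_id.
rewrite eqf eqg -push_comp; apply: eq_push => t _.
exact/esym/Theta_map_comp.
Qed.

Lemma coherent_red r q :
  coherent Omega_red ((r, q) : prior_space R M S) <->
  r = push (Th sel1) q /\ is_prob q.
Proof.
rewrite coherent_generated; split=> [[[_ pq] /(_ _ (or_introl erefl))] //|].
case=> -> pq; split; first by split=> //; apply: is_prob_push.
by move=> x [<-|].
Qed.

Lemma coherent_sel r q :
  coherent Omega_sel ((r, q) : prior_space R M S) <->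
  r = push (Th sel1) q /\ is_prob q /\ marginals_agree q.
Proof.
rewrite coherent_generated; split=> [[[_ pq] coh]|].
  have e1 : r = push (Th sel1) q by exact: coh _ (or_introl erefl).
  have e2 : r = push (Th sel2) q.
    exact: coh _ (or_intror (or_introl erefl)).
  by split=> //; split=> //; rewrite /marginals_agree -e1.
case=> -> [pq agree]; split; first by split=> //; apply: is_prob_push.
by move=> x [<-|[<-|]].
Qed.

(** The second selection is the first one followed by the swap. *)
Lemma swap_symmetric_marginals q : swap_symmetric q -> marginals_agree q.
Proof.
rewrite /marginals_agree => sym_q; rewrite -{1}sym_q -push_comp.
apply: eq_push => -[[m1 m2] s] _.
by rewrite /comp Theta_swap Theta_sel1 Theta_sel2.
Qed.

Lemma coherent_inj r q :
  coherent Omega_inj ((r, q) : prior_space R M S) <->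
  r = push (Th sel1) q /\ is_prob q /\ swap_symmetric q.
Proof.
rewrite coherent_generated; split=> [[[_ pq] coh]|].
  have e1 : r = push (Th sel1) q by exact: coh _ (or_introl erefl).
  have e2 : q = push (Th swap) q.
    exact: coh _ (or_intror (or_intror (or_introl erefl))).
  by split.
case=> -> [pq sym_q]; split; first by split=> //; apply: is_prob_push.
move=> x [<- //|[<-|[<- //|//]]].
exact: swap_symmetric_marginals.
Qed.

(** At a diagonal point all means coincide, so reindexing them along any map
gives the same result. *)
Lemma diagonal_push a (f g : Defs.hom a omega2) q :
  diagonal_supported q -> push (Th f) q = push (Th g) q.
Proof.
move=> diag; apply: eq_push => -[[m1 m2] s] qN0.
have [->|neq] := eqVneq m1 m2; last by rewrite (diag _ _ s neq) eqxx in qN0.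
by apply: eq_param => j /=; rewrite !if_same.
Qed.

(** Coherence along the merge says that [q] is carried by the image of
[Theta_map merge], which is the diagonal.  Conversely, on the diagonal all
morphisms into [omega2] with the same source act alike, and a morphism into
[omega1] is reduced to this case by composing it with [sel1]. *)
Lemma coherent_full r q :
  coherent Omega_full ((r, q) : prior_space R M S) <->
  r = push (Th sel1) q /\ is_prob q /\ diagonal_supported q.
Proof.
split=> [[[_ pq] coh]|[-> [pq diag]]].
  split; first exact: (coh _ _ sel1).
  split=> // m1 m2 s neq.
  have -> : q = push (Th Defs.merge) r by exact: (coh _ _ Defs.merge).
  rewrite ffunE big_pred0 // => -[m s'].
  by apply/eqP; rewrite Theta_merge => -[e1 e2]; rewrite -e1 -e2 eqxx in neq.
split; first by split=> //; apply: is_prob_push.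
have push1 a : push (Th (hom_id a)) =1 @id (vec R (Theta M S a)).
  move=> z; rewrite -[RHS]push_id; apply: eq_push => t _.
  exact: Theta_map_id.
have into2 a (f : Defs.hom a omega2) :
  component ((push (Th sel1) q, q) : prior_space R M S) a = push (Th f) q.
  case: a f => f; first exact: diagonal_push.
  by rewrite (diagonal_push f (hom_id _)) // push1.
move=> a [] f _; last exact: into2.
rewrite (into2 _ (hom_comp sel1 f)) -push_comp.
by apply: eq_push => t _; rewrite Theta_map_comp.
Qed.

End Coherence.

(** * Polytopes and affine dimension *)

Section ConvexHull.
Variables (R : realFieldType) (V : vectType R) (I : finType) (v : I -> V).

(** The index type is an arbitrary finite type, since vertices are indexed by
supports below; [polytope_conv_hull] returns to indices in an ordinal. *)
Definition conv_hull (x : V) : Prop :=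
  exists c : I -> R,
    [/\ forall i, 0 <= c i, \sum_i c i = 1 & x = \sum_i c i *: v i].

Lemma conv_hull_vertex i : conv_hull (v i).
Proof.
exists (fun j => (j == i)%:R); split=> [j||]; first exact: ler0n.
  by rewrite (bigD1 i) //= eqxx big1 ?addr0 // => j /negPf->.
rewrite (bigD1 i) //= eqxx scale1r big1 ?addr0 // => j /negPf->.
exact: scale0r.
Qed.

Lemma conv_hull_convex (a b : R) x y :
  0 <= a -> 0 <= b -> a + b = 1 -> conv_hull x -> conv_hull y ->
  conv_hull (a *: x + b *: y).
Proof.
move=> a0 b0 ab [c [c0 c1 ->]] [d [d0 d1 ->]].
exists (fun i => a * c i + b * d i); split=> [i||].
- by rewrite addr_ge0 // mulr_ge0.
- by rewrite big_split /= -!mulr_sumr c1 d1 !mulr1.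
- rewrite !scaler_sumr -big_split /=.
  by apply: eq_bigr => i _; rewrite scalerDl !scalerA.
Qed.

Lemma polytope_conv_hull (A : V -> Prop) :
  (forall x, A x <-> conv_hull x) -> is_polytope A.
Proof.
move=> AE; exists #|I|, (fun k => v (enum_val k)) => x; rewrite AE.
have bij_ev : {on predT, bijective (@enum_val I predT)}.
  exact: onW_bij (@enum_val_bij I).
split=> -[c [c0 c1 ->]].
  exists (fun k => c (enum_val k)).
  split=> //; last by rewrite (reindex _ bij_ev).
  by rewrite -c1 [RHS](reindex _ bij_ev).
exists (fun i => c (enum_rank i)); split=> //.
  rewrite (reindex _ bij_ev) -c1.
  by apply: eq_bigr => k _; rewrite enum_valK.
rewrite [RHS](reindex _ bij_ev).
by apply: eq_bigr => k _; rewrite enum_valK.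
Qed.

End ConvexHull.

Section LinearImage.
Variables (R : realFieldType) (V W : vectType R) (g : {linear V -> W}).
Variables (A : V -> Prop) (B : W -> Prop).
Hypothesis BE : forall y, B y <-> exists2 x, A x & y = g x.

Lemma polytope_image : is_polytope A -> is_polytope B.
Proof.
case=> n [v Av]; exists n, (g \o v) => y; rewrite BE.
have gsum c : g (\sum_i c i *: v i) = \sum_i c i *: g (v i).
  by rewrite linear_sum; apply: eq_bigr => i _; rewrite linearZ.
split=> [[x /Av[c [c0 c1 ->]] ->]|[c [c0 c1 ->]]]; first by exists c.
by exists (\sum_i c i *: v i); rewrite ?gsum // Av; exists c.
Qed.

Lemma affine_hull_image y :
  affine_hull B y <-> exists2 x, affine_hull A x & y = g x.
Proof.
split=> [[n [z [c [Bz c1 ->]]]]|[x [n [z [c [Az c1 ->]]]] ->]].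
  have /fin_all_exists2[x Ax zE] : forall i, exists2 x, A x & z i = g x.
    by move=> i; apply/BE.
  exists (\sum_i c i *: x i); first by exists n, x, c.
  by rewrite linear_sum; apply: eq_bigr => i _; rewrite linearZ zE.
exists n, (g \o z), c; split=> // [i|]; first by apply/BE; exists (z i).
by rewrite linear_sum; apply: eq_bigr => i _; rewrite linearZ.
Qed.

Lemma affine_dim_image d :
  injective g -> has_affine_dim A d -> has_affine_dim B d.
Proof.
move=> inj_g [x0 [U [dimU hullA]]]; exists (g x0), (linfun g @: U)%VS.
have ker0 : lker (linfun g) == 0%VS.
  by apply/lker0P => x y; rewrite !lfunE => /inj_g.
split=> [|z]; first by rewrite limg_dim_eq ?(eqP ker0) ?capv0.
rewrite affine_hull_image; split=> [[x /hullA xU ->]|/memv_imgP[u uU]].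
  by rewrite -linearB -[g _]lfunE memv_img.
rewrite lfunE => /= e; exists (x0 + u); first by rewrite hullA addrC addKr.
by rewrite linearD -e addrC subrK.
Qed.

End LinearImage.

Section SimplexSlice.
Variables (R : realFieldType) (T : finType) (U : {vspace vec R T}).

Definition simplex_slice (q : vec R T) : Prop := is_prob q /\ q \in U.

Definition supp_in (A : {set T}) (q : vec R T) : Prop :=
  forall t, t \notin A -> q t = 0.

Lemma exists_negative (d : vec R T) :
  \sum_t d t = 0 -> d != 0 -> exists t, d t < 0.
Proof.
move=> d0 dN0; apply/existsP; apply: contraNT dN0 => /existsPn d_ge0.
have {}d_ge0 t : true -> 0 <= (d t : R) by rewrite leNgt d_ge0.
apply/eqP/ffunP => t; rewrite ffunE.
exact: (psumr_eq0P d_ge0 d0).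
Qed.

(** The ray from [x] in a direction [d] of total mass 0 decreases some
coordinate, hence leaves the simplex; it does so at the coordinate where the
ratio [x i / - d i] is minimal among those with [d i < 0]. *)
Lemma ray_exit (A : {set T}) (x d : vec R T) :
  simplex_slice x -> supp_in A x ->
  d \in U -> supp_in A d -> \sum_t d t = 0 -> d != 0 ->
  exists (l : R) (a : T), [/\ 0 <= l, a \in A,
    simplex_slice (x + l *: d) & supp_in (A :\ a) (x + l *: d)].
Proof.
move=> [[x0 x1] xU] xA dU dA d0 /exists_negative[//|i0 di0].
case: (@arg_minP _ R T i0 (fun i => (d i : R) < 0)
         (fun i => x i / - d i)) => // i di min_i.
have di' : 0 < - d i by rewrite oppr_gt0.
have zE t : (x + (x i / - d i) *: d) t = x t + x i / - d i * d t.
  by rewrite !ffunE.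
have l0 : 0 <= x i / - d i by rewrite divr_ge0 // ltW.
exists (x i / - d i), i; split=> //.
- by apply: contraTT di => /dA->; rewrite ltxx.
- split; last by rewrite rpredD // rpredZ.
  split=> [t|].
    rewrite zE; have [dt|dt] := ltP (d t : R) 0; last first.
      by rewrite addr_ge0 // mulr_ge0.
    have := min_i t dt; rewrite ler_pdivlMr ?oppr_gt0 //.
    by rewrite mulrN -subr_ge0 opprK.
  under eq_bigr => t _ do rewrite zE.
  by rewrite big_split /= -mulr_sumr d0 mulr0 addr0.
- move=> t; rewrite in_setD1 negb_and negbK zE => /orP[/eqP->|tA].
    by rewrite invrN mulrN mulNr divfK ?subrr // lt_eqF.
  by rewrite (xA _ tA) (dA _ tA) mulr0 addr0.
Qed.

(** One point [v A] is chosen in the face of each support set [A], with default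
[q0] for an empty face.  These points need not be extreme, but they span the
slice: a point [x] of the face of [A] other than [v A] lies between [v A] and
the exit point of the ray from [x] away from [v A], which belongs to a smaller
face. *)
Lemma simplex_slice_polytope (q0 : vec R T) :
  simplex_slice q0 -> is_polytope simplex_slice.
Proof.
move=> Pq0.
have /fin_all_exists[v vP] (A : {set T}) : exists v, simplex_slice v /\
    ((exists2 x, simplex_slice x & supp_in A x) -> supp_in A v).
  have [[x Px xA]|noA] := classic (exists2 x, simplex_slice x & supp_in A x).
    by exists x.
  by exists q0.
apply: (@polytope_conv_hull _ _ _ v) => x.
split=> [Px|[c [c0 c1 ->]]]; last first.
  split; last first.
    by rewrite rpred_sum // => A _; rewrite rpredZ //; case: (vP A) => -[].
  split=> [t|].
    rewrite sum_ffunE sumr_ge0 // => A _; rewrite ffunE mulr_ge0 //.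
    by case: (vP A) => -[[]].
  under eq_bigr => t _ do rewrite sum_ffunE.
  rewrite exchange_big /= -[RHS]c1; apply: eq_bigr => A _.
  under eq_bigr => t _ do rewrite ffunE.
  by rewrite -scaler_sumr; case: (vP A) => -[[_ ->] _] _; rewrite [LHS]mulr1.
have: supp_in setT x by move=> t; rewrite inE.
move: [set: T] => A; have [n] := ubnP #|A|.
elim: n => // n IHn in A x Px *; rewrite ltnS => leAn xA.
have [[[v0 v1] vU] /(_ (ex_intro2 _ _ x Px xA)) vA] := vP A.
have [->|xNv] := eqVneq x (v A); first exact: conv_hull_vertex.
case: (Px) => -[x0 x1] xU.
have [|t tA||| l [a [l0 aA Pz zA]]] := ray_exit (d := x - v A) Px xA.
- by rewrite rpredB.
- by rewrite !ffunE xA // vA // subrr.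
- under eq_bigr => t _ do rewrite !ffunE.
  by rewrite sumrB x1 v1 subrr.
- by rewrite subr_eq0.
have l1 : 1 + l != 0 by rewrite gt_eqF // ltr_pwDl.
(* The exit point is z = x + l (x - v A), so (1 + l) x = z + l v A. *)
have -> : x = (1 + l)^-1 *: (x + l *: (x - v A)) + (l / (1 + l)) *: v A.
  apply: (scalerI l1); rewrite scalerDr !scalerA divff // mulrCA divff // mulr1.
  by rewrite scale1r scalerBr scalerDl scale1r -addrA subrK.
apply: conv_hull_convex.
- by rewrite invr_ge0 addr_ge0.
- by rewrite divr_ge0 // addr_ge0.
- by rewrite -{1}[_^-1]mul1r -mulrDl divff.
- apply: IHn Pz _ zA; apply: leq_trans leAn; apply: proper_card.
  exact: properD1.
- exact: conv_hull_vertex.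
Qed.

(** The second hypothesis puts [q0] in the relative interior of the slice.  The
affine hull is then the whole of [U] cut by the hyperplane of total mass 1: a
point [z] there lies on the line through [q0] and the nearby slice point
[q0 + e (z - q0)]. *)
Lemma simplex_slice_dim (q0 : vec R T) :
  simplex_slice q0 ->
  (forall u, u \in U -> forall t, q0 t = 0 -> u t = 0) ->
  has_affine_dim simplex_slice (\dim U).-1.
Proof.
move=> Pq0 U0; case: (Pq0) => -[q00 q01] q0U.
pose total (q : vec R T) : R^o := \sum_t q t.
have total_linear : linear total.
  move=> a x y; rewrite /total scaler_sumr -big_split /=.
  by apply: eq_bigr => t _; rewrite !ffunE.
pose totalL := GRing.isLinear.Build R (vec R T) R^o *:%R total total_linear.
pose sigma : {linear vec R T -> R^o} := HB.pack total totalL.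
have sE q : linfun sigma q = \sum_t q t by rewrite lfunE.
exists q0, (U :&: lker (linfun sigma))%VS; split.
  rewrite -(limg_ker_dim (linfun sigma) U).
  suff -> : (linfun sigma @: U)%VS = fullv by rewrite dimvf addn1.
  apply/vspaceP => r; rewrite memvf -[r]mulr1 -[X in _ * X]q01 -sE.
  by apply: rpredZ; rewrite memv_img.
move=> z; rewrite memv_cap memv_ker sE.
split=> [[n [x [c [Px c1 ->]]]]|/andP[zU /eqP z0]].
  rewrite rpredB ?rpred_sum //=; last first.
    by move=> i _; rewrite rpredZ //; case: (Px i).
  under eq_bigr => t _ do rewrite !ffunE.
  rewrite sumrB q01 -sE linear_sum /=.
  under eq_bigr => i _.
    rewrite linearZ /= sE; case: (Px i) => -[_ ->] _; over.
  by rewrite -scaler_suml c1 [_ *: _]mulr1 subrr.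
set u := z - q0 in zU z0.
(* K bounds every ratio |u t| / q0 t, so the step 1 / (1 + K) along u keeps all
   coordinates nonnegative; where q0 t = 0, also u t = 0 and the quotient by
   zero is harmless. *)
pose K : R := \sum_t `|u t : R| / q0 t.
have term_ge0 t : true -> 0 <= `|u t : R| / q0 t by rewrite divr_ge0.
have K0 : 0 <= K by exact: sumr_ge0.
have K1 : 1 + K != 0 by rewrite gt_eqF // ltr_pwDl.
have uK t : `|u t : R| <= K * q0 t.
  have [/(U0 u zU)->|q0t] := eqVneq (q0 t) 0.
    by rewrite normr0 mulr_ge0.
  have q0t_gt0 : 0 < (q0 t : R) by rewrite lt_def q0t q00.
  rewrite -ler_pdivrMr //.
  by rewrite /K (bigD1 t) //= lerDl; apply: sumr_ge0 => i _; apply: term_ge0.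
pose w := q0 + (1 + K)^-1 *: u.
have wE t : w t = q0 t + (1 + K)^-1 * u t by rewrite !ffunE.
have Pw : simplex_slice w.
  split; last by rewrite rpredD // rpredZ.
  split=> [t|].
    rewrite wE -(pmulr_rge0 _ (x := 1 + K)) ?ltr_pwDl //.
    rewrite mulrDr mulVKf // mulrDl mul1r -addrA addr_ge0 //.
    rewrite -lerBlDr sub0r; apply: le_trans (uK t).
    by rewrite -normrN ler_norm.
  under eq_bigr => t _ do rewrite wE.
  by rewrite big_split /= -mulr_sumr q01 z0 mulr0 addr0.
(* z = (1 + K) w - K q0 *)
exists 2, (fun i => if i == ord0 then w else q0),
  (fun i => if i == ord0 then 1 + K else - K); split.
- by move=> i; case: ifP.
- by rewrite !big_ord_recl big_ord0 /= addr0 addrK.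
rewrite !big_ord_recl big_ord0 /= addr0 scalerDr scalerA divff // scale1r.
by rewrite scalerDl scale1r scaleNr addrAC addrK addrC subrK.
Qed.

End SimplexSlice.

(** * Systems of independent linear equations *)

Section VecTools.
Variables (R : realFieldType).

Lemma dim_vec (T : finType) : \dim {: vec R T} = #|T|.
Proof. by rewrite dimvf; exact: muln1. Qed.

Definition pull (T B : finType) (f : B -> T) (q : vec R T) : vec R B :=
  [ffun b => q (f b)].

Lemma pull_linear (T B : finType) (f : B -> T) : linear (pull f).
Proof. by move=> a x y; apply/ffunP => b; rewrite !ffunE. Qed.

HB.instance Definition _ (T B : finType) (f : B -> T) :=
  GRing.isLinear.Build R (vec R T) (vec R B) *:%R (pull f) (pull_linear f).

Lemma push_inj (T B : finType) (h : B -> T) (r : vec R B) b :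
  injective h -> push h r (h b) = r b.
Proof.
move=> inj_h; rewrite ffunE (big_pred1 b) // => c /=.
exact: (inj_eq inj_h).
Qed.

Lemma push_notin_codom (T B : finType) (h : B -> T) (r : vec R B) t :
  (forall b, h b != t) -> push h r t = 0.
Proof. by move=> ht; rewrite ffunE big_pred0 // => b; apply: negbTE. Qed.

(** The section [rho] witnesses that the equations [phi q = 0], indexed by [B],
are independent, so each of them lowers the dimension by one. *)
Lemma solution_space (T B : finType) (phi : vec R T -> vec R B)
    (rho : vec R B -> vec R T) :
  linear phi -> cancel rho phi ->
  exists U : {vspace vec R T},
    (\dim U + #|B| = #|T|)%N /\ forall q, q \in U <-> phi q = 0.
Proof.
move=> phi_linear rhoK.
pose phiL := GRing.isLinear.Build R (vec R T) (vec R B) *:%R phi phi_linear.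
pose f : {linear vec R T -> vec R B} := HB.pack phi phiL.
exists (lker (linfun f)); split=> [|q]; last first.
  by rewrite memv_ker lfunE; split=> [/eqP|/eqP].
rewrite -[in RHS]dim_vec -[RHS](limg_ker_dim (linfun f)) capfv; congr addn.
rewrite -dim_vec; congr (\dim _); apply/esym/vspaceP => r; rewrite memvf.
by apply/memv_imgP; exists (rho r); rewrite ?memvf // lfunE /= rhoK.
Qed.

Definition uniform (T : finType) (D : {set T}) : vec R T :=
  [ffun t => (t \in D)%:R / #|D|%:R].

Lemma is_prob_uniform (T : finType) (D : {set T}) :
  (0 < #|D|)%N -> is_prob (uniform D).
Proof.
move=> D0; split=> [t|]; first by rewrite ffunE divr_ge0 ?ler0n.
under eq_bigr => t _ do rewrite ffunE.
rewrite -mulr_suml -natr_sum -big_mkcond sum1_card divff //.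
by rewrite pnatr_eq0 -lt0n.
Qed.

Lemma uniform_eq0 (T : finType) (D : {set T}) t :
  uniform D t = 0 -> t \notin D.
Proof.
rewrite ffunE => /eqP; apply: contraTN => tD.
rewrite tD mulf_neq0 ?oner_eq0 // invr_neq0 // pnatr_eq0 -lt0n.
by apply/card_gt0P; exists t.
Qed.

Definition point_mass (T : finType) (t : T) : vec R T :=
  [ffun x => (x == t)%:R].

Lemma sum_point_mass (T : finType) (t : T) : \sum_x (x == t)%:R = 1 :> R.
Proof. by rewrite (bigD1 t) //= eqxx big1 ?addr0 // => x /negPf->. Qed.

Lemma push_point_mass (T W : finType) (h : T -> W) (t : T) :
  push h (point_mass t) = point_mass (h t).
Proof.
apply/ffunP => w; rewrite !ffunE eq_sym; under eq_bigr => x _ do rewrite ffunE.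
rewrite big_mkcond (bigD1 t) //= big1 ?eqxx => [|x /negPf->].
  by rewrite addr0; case: eqP.
by rewrite if_same.
Qed.

End VecTools.

(** * Counting the equations of each class *)

Section Constraints.
Variables (R : realFieldType) (M S : finType).
Local Notation Th f := (Theta_map (M := M) (S := S) f).
Local Notation T1 := (Theta M S omega1).
Local Notation T2 := (Theta M S omega2).
Implicit Types (r : vec R T1) (q : vec R T2).

Lemma marginal1E q m s : push (Th sel1) q (m, s) = \sum_m' q (m, m', s).
Proof.
rewrite ffunE (reindex_onto (fun m' => (m, m', s)) (fun t => t.1.2)).
  by apply: eq_bigl => m'; rewrite Theta_sel1 !eqxx.
by move=> [[m1 m2] s']; rewrite Theta_sel1 => /eqP[-> ->].
Qed.

Lemma marginal2E q m s : push (Th sel2) q (m, s) = \sum_m' q (m', m, s).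
Proof.
rewrite ffunE (reindex_onto (fun m' => (m', m, s)) (fun t => t.1.1)).
  by apply: eq_bigl => m'; rewrite Theta_sel2 !eqxx.
by move=> [[m1 m2] s']; rewrite Theta_sel2 => /eqP[-> ->].
Qed.

Lemma swap_symmetricE q :
  swap_symmetric q <-> forall m1 m2 s, q (m1, m2, s) = q (m2, m1, s).
Proof.
have swE m1 m2 s : push (Th swap) q (m1, m2, s) = q (m2, m1, s).
  rewrite ffunE (big_pred1 (m2, m1, s)) // => -[[a b] c].
  by rewrite Theta_swap /= !xpair_eqE [(b == _) && _]andbC.
split=> [sym m1 m2 s|sym]; first by rewrite -swE sym.
by apply/ffunP => -[[m1 m2] s]; rewrite swE sym.
Qed.

(** Both marginals have the same total mass at each dispersion, so agreement at
all means other than [m0] forces agreement at [m0]. *)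
Lemma marginals_agreeP m0 q :
  marginals_agree q <->
  forall m s, m != m0 -> push (Th sel1) q (m, s) = push (Th sel2) q (m, s).
Proof.
split=> [-> //|agree]; apply/ffunP => -[m s].
have [->|/agree //] := eqVneq m m0.
have : \sum_m push (Th sel1) q (m, s) = \sum_m push (Th sel2) q (m, s).
  under eq_bigr => a _ do rewrite marginal1E.
  under [RHS]eq_bigr => a _ do rewrite marginal2E.
  exact: exchange_big.
rewrite (bigD1 m0) // [RHS](bigD1 m0) //=.
rewrite (eq_bigr (fun m => push (Th sel2) q (m, s))) => [/addIr //|a].
exact: agree.
Qed.

(** The equations at the means [m != m0] are independent: mass placed at
[(m, m0, s)] changes the first marginal at [(m, s)], and the second marginal
only at [m0], where no equation is imposed. *)
Lemma marginals_space (m0 : M) : exists U : {vspace vec R T2},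
  (\dim U + (#|M| - 1) * #|S| = #|M| ^ 2 * #|S|)%N /\
  forall q, q \in U <-> marginals_agree q.
Proof.
pose B : finType := ({m : M | m != m0} * S)%type.
pose f (b : B) : T1 := (val b.1, b.2).
have inj_f : injective f by move=> [m s] [m' s'] [/val_inj-> ->].
pose phi q : vec R B := pull f (push (Th sel1) q) - pull f (push (Th sel2) q).
have phiE q b : phi q b = push (Th sel1) q (f b) - push (Th sel2) q (f b).
  by rewrite !ffunE.
pose rho : vec R B -> vec R T2 := push (fun b => (val b.1, m0, b.2)).
have [||U [dimU UE]] := @solution_space R T2 B phi rho.
- by move=> a x y; rewrite /phi !linearP /= addrACA scalerDr.
- move=> z; apply/ffunP => b; rewrite phiE -!push_comp.
  rewrite (@eq_push _ _ _ _ f) => [|c _]; last exact: Theta_sel1.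
  rewrite push_inj // (@push_notin_codom _ _ _ _ _ (f b)) ?subr0 // => c.
  apply/eqP; rewrite /comp Theta_sel2 => -[m0E _].
  by case/negP: (valP b.1); apply/eqP.
exists U; split=> [|q].
  have <- : #|B| = ((#|M| - 1) * #|S|)%N.
    by rewrite card_prod card_sig cardC1 subn1.
  by rewrite dimU !card_prod -mulnn.
rewrite UE (marginals_agreeP m0); split=> [phi0 m s neq|agree].
  have /ffunP/(_ (exist _ m neq, s)) := phi0.
  by rewrite phiE [RHS]ffunE => /subr0_eq.
by apply/ffunP => -[[m neq] s]; rewrite phiE [RHS]ffunE agree // subrr.
Qed.

Lemma card_offdiag : (#|{: {p : M * M | p.1 != p.2}}| = #|M| * (#|M| - 1))%N.
Proof.
have := cardC [pred p : M * M | p.1 == p.2]; rewrite card_prod card_sig.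
have -> : #|[pred p : M * M | p.1 == p.2]| = #|M|.
  have inj_d : injective (fun m : M => (m, m)) by move=> m m' [].
  rewrite -(card_codom inj_d); apply: eq_card => -[m m'] /=.
  apply/eqP/codomP => [/= ->|[a [-> ->]] //]; by exists m'.
rewrite mulnBr muln1 => <-; rewrite addKn.
by apply: eq_card.
Qed.

(** An arbitrary total order on the means; it selects one ordering of each
unordered pair. *)
Definition increasing (p : M * M) := (enum_rank p.1 < enum_rank p.2)%N.

(** The swap exchanges the increasing and the decreasing pairs, so each kind
makes up half of the off-diagonal pairs. *)
Lemma card_increasing : #|{: {p : M * M | increasing p}}| = 'C(#|M|, 2).
Proof.
rewrite bin2 -subn1 -card_offdiag !card_sig -!sum1_card.
rewrite [in RHS](bigID increasing) /=.
have neqE (a b : M) : (a != b) = (enum_rank a != enum_rank b :> nat).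
  by rewrite val_eqE (inj_eq enum_rank_inj).
have swapK : involutive (fun p : M * M => (p.2, p.1)) by case.
rewrite [in RHS]addnC [X in (X + _)%N](reindex_inj (inv_inj swapK)) /=.
rewrite [X in (X + _)%N](eq_bigl increasing) => [|p]; last first.
  by rewrite inE /= neqE /increasing /=; case: ltngtP.
rewrite [X in (_ + X)%N](eq_bigl increasing) => [|p]; last first.
  by rewrite inE /= neqE /increasing /=; case: ltngtP.
by rewrite addnn doubleK; apply: eq_bigl => p; rewrite inE.
Qed.

(** One equation for each increasing pair: mass placed at [(m1, m2, s)] with
[m1 < m2] affects no other of these equations. *)
Lemma symmetric_space : exists U : {vspace vec R T2},
  (\dim U + 'C(#|M|, 2) * #|S| = #|M| ^ 2 * #|S|)%N /\
  forall q, q \in U <-> swap_symmetric q.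
Proof.
pose B : finType := ({p : M * M | increasing p} * S)%type.
pose f (b : B) : T2 := (val b.1, b.2).
have inj_f : injective f by move=> [m s] [m' s'] [/val_inj-> ->].
pose f' (b : B) : T2 := ((val b.1).2, (val b.1).1, b.2).
pose phi q : vec R B := pull f q - pull f' q.
have phiE q b : phi q b = q (f b) - q (f' b) by rewrite !ffunE.
have [||U [dimU UE]] := @solution_space R T2 B phi (push f).
- by move=> a x y; rewrite /phi !linearP /= addrACA scalerDr.
- move=> z; apply/ffunP => b; rewrite phiE push_inj //.
  rewrite push_notin_codom ?subr0 // => c; apply/eqP => -[cE _].
  have := valP c.1; have := valP b.1.
  rewrite /= cE /increasing /= => /ltnW.
  by rewrite leqNgt => /negP.
exists U; split=> [|q].
  have <- : #|B| = ('C(#|M|, 2) * #|S|)%N by rewrite card_prod card_increasing.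
  by rewrite dimU !card_prod -mulnn.
rewrite UE swap_symmetricE; split=> [phi0 m1 m2 s|sym]; last first.
  apply/ffunP => -[[[m1 m2] inc] s]; rewrite phiE [RHS]ffunE.
  by apply/eqP; rewrite subr_eq0; apply/eqP; exact: sym.
have sym a b : increasing (a, b) -> q (a, b, s) = q (b, a, s).
  move=> inc; have /ffunP/(_ (exist _ (a, b) inc, s)) := phi0.
  by rewrite phiE [RHS]ffunE => /subr0_eq.
have [m12|m21|/val_inj/enum_rank_inj-> //] :=
  ltngtP (enum_rank m1) (enum_rank m2); first exact: sym.
exact/esym/sym.
Qed.

Lemma diagonal_space : exists U : {vspace vec R T2},
  (\dim U + #|M| * (#|M| - 1) * #|S| = #|M| ^ 2 * #|S|)%N /\
  forall q, q \in U <-> diagonal_supported q.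
Proof.
pose B : finType := ({p : M * M | p.1 != p.2} * S)%type.
pose f (b : B) : T2 := (val b.1, b.2).
have inj_f : injective f by move=> [m s] [m' s'] [/val_inj-> ->].
have [||U [dimU UE]] := @solution_space R T2 B (pull f) (push f).
- exact: linearP.
- by move=> z; apply/ffunP => b; rewrite [LHS]ffunE push_inj.
exists U; split=> [|q].
  have <- : #|B| = (#|M| * (#|M| - 1) * #|S|)%N.
    by rewrite card_prod card_offdiag.
  by rewrite dimU !card_prod -mulnn.
rewrite UE; split=> [q0 m1 m2 s neq|diag].
  by have /ffunP/(_ (exist _ (m1, m2) neq, s)) := q0; rewrite !ffunE.
by apply/ffunP => -[[[m1 m2] neq] s]; rewrite !ffunE diag.
Qed.

(** Each of the four classes falls under this statement, since the first
component of a coherent prior is a linear function of the second. *)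
Lemma coherent_polytope_dim (Q : morphisms) (U : {vspace vec R T2}) q0 :
  (forall r q, coherent Q ((r, q) : prior_space R M S) <->
     r = push (Th sel1) q /\ simplex_slice U q) ->
  simplex_slice U q0 ->
  (forall q, q \in U -> forall t, q0 t = 0 -> q t = 0) ->
  is_polytope (@coherent R M S Q) /\
  has_affine_dim (@coherent R M S Q) (\dim U).-1.
Proof.
move=> cohE Uq0 U0.
pose g q : prior_space R M S := (push (Th sel1) q, q).
have g_linear : linear g by move=> a x y; rewrite /g linearP.
pose gL :=
  GRing.isLinear.Build R (vec R T2) (prior_space R M S) *:%R g g_linear.
pose f : {linear vec R T2 -> prior_space R M S} := HB.pack g gL.
have BE pi : coherent Q pi <-> exists2 q, simplex_slice U q & pi = f q.
  case: pi => r q; rewrite cohE; split=> [[-> Uq]|[q' Uq' [-> ->]] //].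
  by exists q.
split; first exact: (polytope_image BE (simplex_slice_polytope Uq0)).
by apply: (affine_dim_image BE _ (simplex_slice_dim Uq0 U0)) => x y [].
Qed.

(** With two means [a] and [b], the marginals at [a] share the term
[q (a, a, s)]; cancelling it leaves [q (a, b, s) = q (b, a, s)]. *)
Lemma two_means_symmetric q :
  (#|M| <= 2)%N -> marginals_agree q -> swap_symmetric q.
Proof.
move=> M2 agree; apply/swap_symmetricE => a b s.
have [-> //|neq] := eqVneq a b.
have sum2 (F : M -> R) : \sum_m F m = F a + F b.
  rewrite (bigD1 a) //= (bigD1 b) 1?eq_sym //= big1 ?addr0 // => c /andP[ca cb].
  have : (#|[set a; b; c]| <= #|M|)%N by exact: max_card.
  rewrite -setUA cardsU1 cards2 !inE negb_or neq [a == c]eq_sym ca /=.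
  by rewrite [b == c]eq_sym cb /= => /leq_trans/(_ M2).
have /ffunP/(_ (a, s)) := agree.
by rewrite marginal1E marginal2E !sum2 => /addrI.
Qed.

(** Along a cycle [a -> b -> c -> a] each mean occurs once as a source and once
as a target, so the marginals agree, while no arrow is reversed. *)
Lemma cyclic_counterexample (s : S) : (2 < #|M|)%N ->
  exists q, [/\ is_prob q, marginals_agree q & ~ swap_symmetric q].
Proof.
case/card_gt2P => a [b [c [_ [ab bc ca]]]].
pose q : vec R T2 := 3^-1 *: (point_mass R ((a, b, s) : T2)
  + point_mass R ((b, c, s) : T2) + point_mass R ((c, a, s) : T2)).
have qE t : q t = 3^-1 * ((t == (a, b, s))%:R + (t == (b, c, s))%:R
                          + (t == (c, a, s))%:R) by rewrite !ffunE.
exists q; split.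
- split=> [t|]; first by rewrite qE mulr_ge0 ?invr_ge0 ?addr_ge0 ?ler0n.
  under eq_bigr => t _ do rewrite qE.
  rewrite -mulr_sumr !big_split /= !sum_point_mass.
  by field.
- rewrite /marginals_agree /q !linearZ !linearD /= !push_point_mass.
  rewrite !Theta_sel1 !Theta_sel2; congr (_ *: _).
  by rewrite [RHS]addrC addrA.
- move=> /swap_symmetricE/(_ a b s) /eqP.
  rewrite !qE !xpair_eqE !eqxx /= (negPf ab) [b == a]eq_sym (negPf ab) /=.
  rewrite (negPf bc) [a == c]eq_sym (negPf ca) /= !addr0 mulr0 mulr1.
  by rewrite invr_eq0 pnatr_eq0.
Qed.

End Constraints.

(** Here the arguments are the dimensions of the linear subspaces [U], as given
by the numbers of equations.  The equivalence rests on
['C(m, 2) - (m - 1) = 'C(m - 1, 2)], which vanishes exactly for [m <= 2]. *)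
Lemma dimensions_arith (m s dred dsel dinj dfull : nat) :
  (0 < m)%N -> (0 < s)%N ->
  (dred = m ^ 2 * s)%N ->
  (dsel + (m - 1) * s = m ^ 2 * s)%N ->
  (dinj + 'C(m, 2) * s = m ^ 2 * s)%N ->
  (dfull + m * (m - 1) * s = m ^ 2 * s)%N ->
  [/\ dred.-1%:Q = m%:Q ^+ 2 * s%:Q - 1,
      dsel.-1%:Q = m%:Q ^+ 2 * s%:Q - 1 - s%:Q * (m%:Q - 1),
      dinj.-1%:Q = 1 / 2%:Q * m%:Q * (m%:Q + 1) * s%:Q - 1 &
      dfull.-1%:Q = m%:Q * s%:Q - 1]
  /\ (dsel.-1 = dinj.-1 <-> (m <= 2)%N)
  /\ dsel.-1%:Q - dinj.-1%:Q = s%:Q * ('C(m - 1, 2))%:Q.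
Proof.
case: m => // k _; case: s => // l _; rewrite subn1 /= binS bin1.
have : ('C(k, 2) * 2 + k = k * k)%N.
  rewrite bin2 muln2; have := odd_double_half (k * k.-1).
  by case: k => // k; rewrite oddM /= andNb add0n => ->; nia.
set c := 'C(k, 2) => cE redE selE injE fullE.
case: dred redE => [|dred] redE; first by nia.
case: dsel selE => [|dsel] selE; first by nia.
case: dinj injE => [|dinj] injE; first by nia.
case: dfull fullE => [|dfull] fullE; first by nia.
rewrite /= in redE selE injE fullE *.
have toQ (x y : nat) : x = y -> x%:R = y%:R :> rat by move->.
move/toQ: (selE); move/toQ: (injE); move/toQ: (fullE).
move/toQ: (redE); move/toQ: (cE).
rewrite -!pmulrn.
have S1 (x : nat) : x.+1%:R = x%:R + 1 :> rat by rewrite -natr1.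
rewrite !(natrD, natrM, natrX, S1).
move=> cQ redQ fullQ injQ selQ.
have {}cQ : c%:R = (k%:R * k%:R - k%:R) / 2 :> rat by rewrite -cQ; field.
have {}redQ := canRL (addrK _) redQ.
have {}selQ := canRL (addrK _) (canRL (addrK _) selQ).
have {}injQ := canRL (addrK _) (canRL (addrK _) injQ).
have {}fullQ := canRL (addrK _) (canRL (addrK _) fullQ).
split; last split.
- by split; rewrite ?redQ ?selQ ?injQ ?fullQ ?cQ; field.
- have -> : (k < 2)%N = (c == 0)%N by rewrite /c eqn0Ngt bin_gt0 ltnNge.
  by split=> [?|/eqP c0]; [apply/eqP|]; nia.
- by rewrite selQ injQ; ring.
Qed.

(** * The proposition *)

Lemma diagonal_supported_uniform (R : realFieldType) (M S : finType) :
  diagonal_supported (uniform R [set t : Theta M S omega2 | t.1.1 == t.1.2]).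
Proof. by move=> m1 m2 s neq; rewrite ffunE inE /= (negPf neq) mul0r. Qed.

Theorem proposition8p4 (R : realFieldType) (M S : finType)
    (hM : (0 < #|M|)%N) (hS : (0 < #|S|)%N) :
  [/\ proper_subcat Omega_red Omega_sel,
      proper_subcat Omega_sel Omega_inj &
      proper_subcat Omega_inj Omega_full]
  /\
  [/\ is_polytope (@coherent R M S Omega_red),
      is_polytope (@coherent R M S Omega_sel),
      is_polytope (@coherent R M S Omega_inj) &
      is_polytope (@coherent R M S Omega_full)]
  /\
  (exists d_red d_sel d_inj d_full : nat,
    [/\ has_affine_dim (@coherent R M S Omega_red) d_red,
        has_affine_dim (@coherent R M S Omega_sel) d_sel,
        has_affine_dim (@coherent R M S Omega_inj) d_inj &
        has_affine_dim (@coherent R M S Omega_full) d_full]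
    /\
    [/\ d_red%:Q = #|M|%:Q ^+ 2 * #|S|%:Q - 1,
        d_sel%:Q = #|M|%:Q ^+ 2 * #|S|%:Q - 1 - #|S|%:Q * (#|M|%:Q - 1),
        d_inj%:Q = 1 / 2%:Q * #|M|%:Q * (#|M|%:Q + 1) * #|S|%:Q - 1 &
        d_full%:Q = #|M|%:Q * #|S|%:Q - 1]
    /\
    (d_sel = d_inj <-> (#|M| <= 2)%N)
    /\
    d_sel%:Q - d_inj%:Q = #|S|%:Q * ('C(#|M| - 1, 2))%:Q)
  /\
  [/\ forall q, @coherent_second R M S Omega_red q <-> is_prob q,
      forall q, @coherent_second R M S Omega_sel q <->
        is_prob q /\ marginals_agree q,
      forall q, @coherent_second R M S Omega_inj q <->
        is_prob q /\ swap_symmetric q &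
      forall q, @coherent_second R M S Omega_full q <->
        is_prob q /\ diagonal_supported q]
  /\
  (#|M| = 2%N -> forall q : vec R (Theta M S omega2),
     is_prob q -> marginals_agree q -> swap_symmetric q)
  /\
  ((3 <= #|M|)%N -> exists q : vec R (Theta M S omega2),
     [/\ is_prob q, marginals_agree q & ~ swap_symmetric q]).
Proof.
have /card_gt0P[m0 _] := hM; have /card_gt0P[s0 _] := hS.
split; first by split; [exact: red_proper_sel | exact: sel_proper_inj
                       | exact: inj_proper_full].
have [Usel [dimUsel UselE]] := marginals_space R S m0.
have [Uinj [dimUinj UinjE]] := symmetric_space R M S.
have [Ufull [dimUfull UfullE]] := diagonal_space R M S.
have cardT2 : #|Theta M S omega2| = (#|M| ^ 2 * #|S|)%N.
  by rewrite !card_prod mulnn.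
pose qu := uniform R [set: Theta M S omega2].
pose qd := uniform R [set t : Theta M S omega2 | t.1.1 == t.1.2].
have qu_prob : is_prob qu.
  by apply: is_prob_uniform; apply/card_gt0P; exists (m0, m0, s0); rewrite inE.
have qd_prob : is_prob qd.
  by apply: is_prob_uniform; apply/card_gt0P; exists (m0, m0, s0);
     rewrite inE /=.
have qu_sym : swap_symmetric qu.
  by apply/swap_symmetricE => m1 m2 s; rewrite !ffunE !inE.
(* qu vanishes nowhere, so it can serve as q0 for every subspace. *)
have qu_supp (U : {vspace vec R (Theta M S omega2)}) q :
    q \in U -> forall t, qu t = 0 -> q t = 0.
  by move=> _ t /uniform_eq0; rewrite inE.
have [||red_pol red_dim] :=
  @coherent_polytope_dim R M S Omega_red fullv qu _ _ (qu_supp _).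
- move=> r q; rewrite coherent_red; split=> [[-> pq]|[-> []]] //.
  by rewrite /simplex_slice memvf.
- by split; rewrite ?memvf.
have [||sel_pol sel_dim] :=
  @coherent_polytope_dim R M S Omega_sel Usel qu _ _ (qu_supp _).
- by move=> r q; rewrite coherent_sel /simplex_slice UselE.
- by split=> //; apply/UselE/swap_symmetric_marginals.
have [||inj_pol inj_dim] :=
  @coherent_polytope_dim R M S Omega_inj Uinj qu _ _ (qu_supp _).
- by move=> r q; rewrite coherent_inj /simplex_slice UinjE.
- by split=> //; apply/UinjE.
have [|||full_pol full_dim] :=
  @coherent_polytope_dim R M S Omega_full Ufull qd.
- by move=> r q; rewrite coherent_full /simplex_slice UfullE.
- by split=> //; apply/UfullE/diagonal_supported_uniform.
- move=> q /UfullE diag [[m1 m2] s] /uniform_eq0.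
  by rewrite inE => /diag->.
split; first by split.
split.
  exists (\dim {: vec R (Theta M S omega2)}).-1, (\dim Usel).-1, (\dim Uinj).-1,
    (\dim Ufull).-1.
  split; first by split.
  apply: dimensions_arith => //.
  by rewrite dim_vec.
split; last split.
- split=> q; split.
  + by case=> r /coherent_red[].
  + by move=> ?; eexists; apply/coherent_red; split.
  + by case=> r /coherent_sel[].
  + by move=> ?; eexists; apply/coherent_sel; split.
  + by case=> r /coherent_inj[].
  + by move=> ?; eexists; apply/coherent_inj; split.
  + by case=> r /coherent_full[].
  + by move=> ?; eexists; apply/coherent_full; split.
- by move=> M2 q _; apply: two_means_symmetric; rewrite M2.
- exact: cyclic_counterexample.
Qed.
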